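(* Let $(X_n)_{n\ge0}$ be a Galton–Watson process with $X_0=1$ and $X_n=\sum_{k=1}^{X_{n-1}}Y_{n,k}$, where $(Y_{n,k})$ are i.i.d. nonnegative integer-valued random variables with finite mean $m>1$ and finite variance, and assume the process a.s. never becomes extinct (i.e. $\mathbb{P}(X_n=0\text{ for some }n)=0$). Let $L(t)=\log\mathbb{E}[\exp(t(Y_{n,k}-m))]$ and assume $L$ is finite on $[-c,c]$ for some $c>0$; let $I(x)=\sup_{-c\le t\le c}\{xt-L(t)\}$ and $J(x)=\min(I(x),I(-x))$. Define $\tilde m_n=X_n/X_{n-1}$, $\hat m_n=\frac{\sum_{k=1}^nX_k}{\sum_{k=1}^nX_{k-1}}$, and $S_n=\sum_{k=0}^nX_k$. Then for all $n\ge1$ and $x>0$, $$\mathbb{P}(|\tilde m_n-m|\ge x)\le2\,\mathbb{E}[\exp(-J(x)X_{n-1})],$$ $$\mathbb{P}(|\tilde m_n-m|\ge x)\le2\inf_{p>1}\big(\mathbb{E}[\exp(-(p-1)J(x)X_{n-1})]\big)^{1/p},$$ $$\mathbb{P}(|\hat m_n-m|\ge x)\le2\inf_{p>1}\big(\mathbb{E}[\exp(-(p-1)J(x)S_{n-1})]\big)^{1/p}.$$ *)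

(* Defs.v *)
(* No measure theory is installed, so the
   Galton-Watson process is described through its law: a Markov chain on nat
   with X_0 = 1 and transition P(X_k = j | X_{k-1} = i) = p^{*i}(j),
   where p is the offspring pmf.  Probabilities / expectations of functions of
   (X_0,...,X_n) are (nested) countable sums over paths. *)
From Stdlib Require Import Reals List ClassicalEpsilon.
Open Scope R_scope.
Import ListNotations.

(* value of a convergent real series (0 if it does not converge) *)
Definition Psum (f : nat -> R) : R :=
  epsilon (inhabits 0) (fun l => infinite_sum f l).

(* i-fold convolution power of the offspring pmf: P(Y_1+...+Y_i = j) *)
Fixpoint conv (p : nat -> R) (i j : nat) : R :=
  match i with
  | O => if Nat.eqb j 0 then 1 else 0
  | S i' => sum_f_R0 (fun a => p a * conv p i' (j - a)) j
  end.

(* Expectation of f over n further generations, given the history h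
   (h = [x_0; ...; x_k], last element = current population). *)
Fixpoint Ex (p : nat -> R) (n : nat) (h : list nat) (f : list nat -> R) : R :=
  match n with
  | O => f h
  | S n' => Psum (fun j => conv p (last h 0%nat) j * Ex p n' (h ++ [j]) f)
  end.

Definition GWE (p : nat -> R) (n : nat) (f : list nat -> R) : R :=
  Ex p n [1%nat] f.

Definition GWP (p : nat -> R) (n : nat) (A : list nat -> Prop) : R :=
  GWE p n (fun h => if excluded_middle_informative (A h) then 1 else 0).

Definition Xk (h : list nat) (k : nat) : R := INR (nth k h 0%nat).

Definition Sk (h : list nat) (k : nat) : R := sum_f_R0 (fun i => Xk h i) k.

Definition mtilde (h : list nat) (n : nat) : R := Xk h n / Xk h (n - 1).

Definition mhat (h : list nat) (n : nat) : R :=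
  sum_f_R0 (fun k => Xk h (S k)) (n - 1) / sum_f_R0 (fun k => Xk h k) (n - 1).

Definition Lf (p : nat -> R) (m t : R) : R :=
  ln (Psum (fun k => p k * exp (t * (INR k - m)))).

Definition If (p : nat -> R) (m c x : R) : R :=
  epsilon (inhabits 0)
    (is_lub (fun y => exists t, -c <= t <= c /\ y = x * t - Lf p m t)).

Definition Jf (p : nat -> R) (m c x : R) : R := Rmin (If p m c x) (If p m c (- x)).

(* Main.v *)
Require Import Defs.
From Stdlib Require Import Reals List ClassicalEpsilon Lra Lia Psatz FunctionalExtensionality Classical.
Open Scope R_scope.
Import ListNotations.

(* Conditionally on the past, [X_n] is a sum of [X_(n-1)] independent offspring
   variables, whose law is the convolution power [conv p X_(n-1)].  The proof:
   - develops series with nonnegative terms, the Cauchy product and hence the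
     multiplicativity of moment generating functions under convolution;
   - shows that the path expectation [Ex] is a positive linear functional and
     proves Hölder's inequality (in exponential form) and Lyapunov's inequality;
   - proves Chernoff's bound P(|S_K/K - m| >= x) <= 2 exp(-J(x) K) for sums of K
     offspring variables, by exponential Markov and a passage to the supremum
     defining the Cramér transform [I];
   - conditions on the first n-1 generations to get the first bound, and applies
     Lyapunov's inequality to get the second;
   - for the pooled estimator, uses the exponential martingale
     exp(u (sum (X_(k+1) - m X_k)) - L(u) (sum X_k)) of mean 1 and Hölder's
     inequality at each point of the Cramér supremum, then passes to the supremum. *)

Lemma partial_sum_mono (f : nat -> R) (N n : nat) :
  (forall k, 0 <= f k) -> (N <= n)%nat -> sum_f_R0 f N <= sum_f_R0 f n.
Proof.
  intros Hf H. induction H as [|n _ IH]; [lra|].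
  rewrite tech5. specialize (Hf (S n)). lra.
Qed.

Lemma series_le (f g : nat -> R) (a b : R) :
  infinite_sum f a -> infinite_sum g b -> (forall n, f n <= g n) -> a <= b.
Proof. intros Ha Hb H. exact (Rle_cv_lim (fun n => sum_growing f g n H) Ha Hb). Qed.

Lemma series_ext (f g : nat -> R) (l : R) :
  (forall n, f n = g n) -> infinite_sum f l -> infinite_sum g l.
Proof. intros H. replace g with f; auto. apply functional_extensionality; auto. Qed.

Lemma series_zero : infinite_sum (fun _ => 0) 0.
Proof.
  intros eps He. exists O. intros n _. rewrite sum_cte. unfold Rdist.
  rewrite Rmult_0_l, Rminus_diag, Rabs_R0. lra.
Qed.

Lemma series_plus (f g : nat -> R) (a b : R) :
  infinite_sum f a -> infinite_sum g b -> infinite_sum (fun n => f n + g n) (a + b).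
Proof.
  intros Ha Hb eps He. destruct (CV_plus _ _ _ _ Ha Hb eps He) as [N HN].
  exists N. intros n Hn. rewrite sum_plus. apply HN; auto.
Qed.

Lemma series_scal (f : nat -> R) (a c : R) :
  infinite_sum f a -> infinite_sum (fun n => c * f n) (c * a).
Proof.
  intros Ha.
  assert (Hc : Un_cv (fun _ => c) c).
  { intros eps He; exists O; intros; unfold Rdist; rewrite Rminus_diag, Rabs_R0; lra. }
  intros eps He. destruct (CV_mult _ _ _ _ Hc Ha eps He) as [N HN].
  exists N. intros n Hn.
  replace (sum_f_R0 (fun k => c * f k) n) with (c * sum_f_R0 f n).
  - apply HN; auto.
  - rewrite scal_sum. apply sum_eq. intros; ring.
Qed.

Lemma series_nonneg (f : nat -> R) (l : R) :
  (forall k, 0 <= f k) -> infinite_sum f l -> 0 <= l.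
Proof. intros Hf Hs. exact (series_le _ _ _ _ series_zero Hs Hf). Qed.

Lemma series_pos (f : nat -> R) (l : R) (j : nat) :
  (forall k, 0 <= f k) -> 0 < f j -> infinite_sum f l -> 0 < l.
Proof.
  intros Hf Hj Hs. pose proof (sum_incr f j l Hs Hf) as Hle.
  destruct j as [|j]; [simpl in Hle; lra|].
  rewrite tech5 in Hle. pose proof (cond_pos_sum f j Hf). lra.
Qed.

Lemma series_comparison (f g : nat -> R) (b : R) :
  (forall n, 0 <= f n <= g n) -> infinite_sum g b ->
  exists a, infinite_sum f a /\ a <= b.
Proof.
  intros H Hb. destruct (Rseries_CV_comp f g H (exist _ b Hb)) as [a Ha].
  exists a. split; auto. apply (series_le f g); auto. intros n; apply H.
Qed.

Lemma Psum_eq (f : nat -> R) (l : R) : infinite_sum f l -> Psum f = l.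
Proof.
  intros H. unfold Psum.
  pose proof (epsilon_spec (inhabits 0) (fun l => infinite_sum f l) (ex_intro _ l H)).
  eapply uniqueness_sum; eauto.
Qed.

Section CauchyProduct.
Variables (a b : nat -> R).
Hypotheses (Ha : forall k, 0 <= a k) (Hb : forall k, 0 <= b k).

Definition cauchy_coef (j : nat) : R := sum_f_R0 (fun i => a i * b (j - i)%nat) j.

Lemma cauchy_partial_sum (M : nat) :
  sum_f_R0 cauchy_coef M = sum_f_R0 (fun i => a i * sum_f_R0 b (M - i)) M.
Proof.
  induction M as [|M IH].
  - unfold cauchy_coef. simpl. ring.
  - rewrite tech5, IH, tech5, Nat.sub_diag.
    rewrite (sum_eq (fun i => a i * sum_f_R0 b (S M - i))
                    (fun i => a i * sum_f_R0 b (M - i) + a i * b (S M - i)%nat)).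
    2:{ intros i Hi. replace (S M - i)%nat with (S (M - i)) by lia. rewrite tech5. ring. }
    rewrite sum_plus. unfold cauchy_coef. rewrite tech5, Nat.sub_diag. simpl. ring.
Qed.

Lemma cauchy_coef_nonneg (j : nat) : 0 <= cauchy_coef j.
Proof. apply cond_pos_sum. intros; apply Rmult_le_pos; auto. Qed.

Lemma cauchy_partial_bounds (B : R) :
  infinite_sum b B ->
  (forall M, sum_f_R0 cauchy_coef M <= sum_f_R0 a M * B) /\
  (forall N K, sum_f_R0 a N * sum_f_R0 b K <= sum_f_R0 cauchy_coef (N + K)).
Proof.
  intros HB. split.
  - intros M. rewrite cauchy_partial_sum, Rmult_comm, scal_sum.
    apply sum_Rle. intros i _. apply Rmult_le_compat_l; auto.
    apply sum_incr; auto.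
  - intros N K. rewrite cauchy_partial_sum.
    apply Rle_trans with (sum_f_R0 (fun i => a i * sum_f_R0 b (N + K - i)) N).
    + rewrite Rmult_comm, scal_sum. apply sum_Rle. intros i Hi.
      apply Rmult_le_compat_l; auto. apply partial_sum_mono; auto; lia.
    + apply partial_sum_mono; [|lia]. intros; apply Rmult_le_pos; auto.
      apply cond_pos_sum; auto.
Qed.

Lemma cauchy_product (A B : R) :
  infinite_sum a A -> infinite_sum b B -> infinite_sum cauchy_coef (A * B).
Proof.
  intros HA HB. destruct (cauchy_partial_bounds B HB) as [Up Lo].
  assert (HAk : forall k, sum_f_R0 a k <= A) by (intros; apply sum_incr; auto).
  assert (HBk : forall k, sum_f_R0 b k <= B) by (intros; apply sum_incr; auto).
  assert (HAp : forall k, 0 <= sum_f_R0 a k) by (intros; apply cond_pos_sum; auto).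
  assert (HBp : forall k, 0 <= sum_f_R0 b k) by (intros; apply cond_pos_sum; auto).
  assert (HA0 : 0 <= A) by (apply (series_nonneg a); auto).
  assert (HB0 : 0 <= B) by (apply (series_nonneg b); auto).
  intros eps He.
  set (d := eps / (A + B + 1)).
  assert (Hd : 0 < d) by (unfold d; apply Rdiv_lt_0_compat; lra).
  assert (Hd2 : d * (A + B) < eps).
  { unfold d. apply Rmult_lt_reg_r with (A + B + 1); [lra|].
    field_simplify; [|lra]. nra. }
  destruct (HA d Hd) as [N HN]. destruct (HB d Hd) as [K HK].
  exists (N + K)%nat. intros M HM.
  specialize (HN N (le_n _)). specialize (HK K (le_n _)). unfold Rdist in *.
  destruct (Rabs_def2 _ _ HN). destruct (Rabs_def2 _ _ HK).
  pose proof (Lo N K). pose proof (partial_sum_mono _ _ _ cauchy_coef_nonneg HM).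
  pose proof (Up M). pose proof (HAk M). pose proof (HAk N). pose proof (HBk K).
  pose proof (HAp N). pose proof (HBp K).
  apply Rabs_def1; nra.
Qed.

End CauchyProduct.

Lemma exp_le_exp (x y : R) : x <= y -> exp x <= exp y.
Proof. intros [H|H]; [left; apply exp_increasing; auto|subst; lra]. Qed.

Lemma exp_le_1 (x : R) : x <= 0 -> exp x <= 1.
Proof. intros H. rewrite <- exp_0. apply exp_le_exp; auto. Qed.

Lemma exp_ge_1 (x : R) : 0 <= x -> 1 <= exp x.
Proof. intros H. pose proof (exp_ineq1_le x). lra. Qed.

Lemma ln_le (x y : R) : 0 < x -> x <= y -> ln x <= ln y.
Proof. intros Hx [H|H]; [left; apply ln_increasing; auto|subst; lra]. Qed.

Lemma exp_INR_mul (K : nat) (a : R) : exp (INR K * a) = exp a ^ K.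
Proof.
  induction K as [|K IH]; [simpl; rewrite Rmult_0_l; apply exp_0|].
  rewrite S_INR. simpl pow. rewrite <- IH, <- exp_plus. f_equal. ring.
Qed.

Lemma exp_convex (s X Y : R) :
  0 <= s <= 1 -> exp (s * X + (1 - s) * Y) <= s * exp X + (1 - s) * exp Y.
Proof.
  intros Hs. set (w := s * X + (1 - s) * Y).
  assert (E1 : exp X = exp w * exp (X - w)) by (rewrite <- exp_plus; f_equal; ring).
  assert (E2 : exp Y = exp w * exp (Y - w)) by (rewrite <- exp_plus; f_equal; ring).
  pose proof (exp_ineq1_le (X - w)). pose proof (exp_ineq1_le (Y - w)).
  pose proof (exp_pos w).
  assert (Ht : s * (exp w * (1 + (X - w))) + (1 - s) * (exp w * (1 + (Y - w))) = exp w)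
    by (unfold w; ring).
  rewrite E1, E2.
  assert (s * (exp w * exp (X - w)) >= s * (exp w * (1 + (X - w)))).
  { apply Rle_ge, Rmult_le_compat_l; [lra|]. apply Rmult_le_compat_l; lra. }
  assert ((1 - s) * (exp w * exp (Y - w)) >= (1 - s) * (exp w * (1 + (Y - w)))).
  { apply Rle_ge, Rmult_le_compat_l; [lra|]. apply Rmult_le_compat_l; lra. }
  lra.
Qed.

Lemma exp_bound_lub (E : R -> Prop) (I k a : R) :
  is_lub E I -> k <= 0 -> (forall y, E y -> a <= exp (k * y)) -> a <= exp (k * I).
Proof.
  intros [_ Hleast] Hk H.
  assert (Hne : exists y, E y).
  { apply NNPP. intros Hn.
    assert (Hup : is_upper_bound E (I - 1)) by (intros y Hy; exfalso; eauto).
    pose proof (Hleast _ Hup). lra. }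
  destruct Hk as [Hk|Hk].
  2:{ destruct Hne as [y Hy]. specialize (H y Hy). subst k. rewrite Rmult_0_l in *. auto. }
  apply Rnot_lt_le. intros Hlt.
  assert (Ha : 0 < a) by (pose proof (exp_pos (k * I)); lra).
  assert (Hb : ln a / k < I).
  { apply ln_increasing in Hlt; [|apply exp_pos]. rewrite ln_exp in Hlt.
    apply Rmult_lt_reg_r with (- k); [lra|].
    replace (ln a / k * - k) with (- ln a) by (field; lra). lra. }
  assert (Hy : exists y, E y /\ ln a / k < y).
  { apply NNPP. intros Hn.
    assert (Hup : is_upper_bound E (ln a / k)).
    { intros y Hy. apply Rnot_lt_le. intros Hlt'. apply Hn. eauto. }
    pose proof (Hleast _ Hup). lra. }
  destruct Hy as [y [Hy Hly]]. specialize (H y Hy).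
  assert (k * y < ln a).
  { replace (ln a) with (k * (ln a / k)) by (field; lra). nra. }
  assert (exp (k * y) < a) by (rewrite <- (exp_ln a) by auto; apply exp_increasing; auto).
  lra.
Qed.

Definition indP (P : Prop) : R := if excluded_middle_informative P then 1 else 0.

Lemma indP_01 (P : Prop) : 0 <= indP P <= 1.
Proof. unfold indP. destruct excluded_middle_informative; lra. Qed.

Lemma indP_or (A B1 B2 : Prop) : (A -> B1 \/ B2) -> indP A <= indP B1 + indP B2.
Proof.
  intros H. unfold indP.
  destruct (excluded_middle_informative A) as [a|a];
  destruct (excluded_middle_informative B1); destruct (excluded_middle_informative B2);
  try lra. destruct (H a); tauto.
Qed.

Lemma ratio_deviation_split (A B m x : R) :
  0 <= A -> 0 <= B -> 0 < x -> Rabs (A / B - m) >= x ->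
  x * (A - m * B) >= x * x * B \/ - x * (A - m * B) >= - x * - x * B.
Proof.
  intros HA HB Hx HE. destruct HB as [HB|HB].
  - set (r := A / B) in HE. replace A with (r * B) by (unfold r; field; lra).
    destruct (Rcase_abs (r - m)) as [Hn|Hn].
    + rewrite Rabs_left in HE by lra. right.
      assert (0 <= (x * B) * (- (r - m) - x)) by (apply Rmult_le_pos; nra). nra.
    + rewrite Rabs_right in HE by lra. left.
      assert (0 <= (x * B) * ((r - m) - x)) by (apply Rmult_le_pos; nra). nra.
  - subst B. left. rewrite !Rmult_0_r, Rminus_0_r. apply Rle_ge, Rmult_le_pos; lra.
Qed.

Lemma last_nth (h : list nat) (k d : nat) : length h = S k -> last h d = nth k h d.
Proof.
  revert k. induction h as [|a h IH]; intros k Hl; [simpl in Hl; lia|].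
  destruct h as [|b h].
  - simpl in Hl. assert (k = 0%nat) by lia. subst. reflexivity.
  - destruct k as [|k]; [simpl in Hl; lia|].
    change (last (a :: b :: h) d) with (last (b :: h) d). rewrite (IH k) by (simpl in *; lia).
    reflexivity.
Qed.

Lemma Xk_app_lt (h : list nat) (j k : nat) : (k < length h)%nat -> Xk (h ++ [j]) k = Xk h k.
Proof. intros H. unfold Xk. rewrite app_nth1; auto. Qed.

Lemma Xk_app_eq (h : list nat) (j k : nat) : length h = k -> Xk (h ++ [j]) k = INR j.
Proof. intros H. unfold Xk. rewrite app_nth2 by lia. rewrite H, Nat.sub_diag. reflexivity. Qed.

Lemma Xk_nonneg (h : list nat) (k : nat) : 0 <= Xk h k.
Proof. apply pos_INR. Qed.

Lemma Xk_last (h : list nat) (k : nat) : length h = S k -> Xk h k = INR (last h 0%nat).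
Proof. intros H. unfold Xk. rewrite (last_nth h k) by auto. reflexivity. Qed.

Fixpoint sumr (f : nat -> R) (n : nat) : R :=
  match n with O => 0 | S n' => sumr f n' + f n' end.

Lemma sumr_S (f : nat -> R) (n : nat) : sumr f (S n) = sum_f_R0 f n.
Proof.
  induction n as [|n IH]; [simpl; ring|].
  change (sumr f (S (S n))) with (sumr f (S n) + f (S n)). rewrite IH, tech5. ring.
Qed.

Lemma sumr_ext (f g : nat -> R) (n : nat) :
  (forall k, (k < n)%nat -> f k = g k) -> sumr f n = sumr g n.
Proof.
  induction n as [|n IH]; intros H; simpl; auto.
  rewrite IH by (intros; apply H; lia). rewrite H by lia. reflexivity.
Qed.

Lemma sumr_nonneg (f : nat -> R) (n : nat) : (forall k, 0 <= f k) -> 0 <= sumr f n.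
Proof. intros H; induction n as [|n IH]; simpl; [lra|]. specialize (H n). lra. Qed.

Lemma sumr_minus_scal (f g : nat -> R) (a : R) (n : nat) :
  sumr (fun k => f k - a * g k) n = sumr f n - a * sumr g n.
Proof. induction n as [|n IH]; simpl; [ring|]. rewrite IH. ring. Qed.

Section GaltonWatson.
Variable p : nat -> R.
Hypothesis Hp : forall k, 0 <= p k.
Hypothesis Hmass : infinite_sum p 1.

Lemma conv_nonneg (K j : nat) : 0 <= conv p K j.
Proof.
  revert j. induction K as [|K IH]; intros j; simpl.
  - destruct (Nat.eqb j 0); lra.
  - apply cond_pos_sum. intros; apply Rmult_le_pos; auto.
Qed.

Lemma conv_mgf (mu t Phi : R) :
  infinite_sum (fun k => p k * exp (t * (INR k - mu))) Phi ->
  forall K, infinite_sum (fun j => conv p K j * exp (t * (INR j - INR K * mu))) (Phi ^ K).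
Proof.
  intros HPhi K. induction K as [|K IH].
  - simpl. intros eps He. exists O. intros n _.
    assert (E : sum_f_R0 (fun j => (if Nat.eqb j 0 then 1 else 0) *
                                   exp (t * (INR j - 0 * mu))) n = 1).
    { induction n as [|n IHn]; simpl.
      - rewrite Rmult_0_l, Rminus_0_r, Rmult_0_r, exp_0. ring.
      - rewrite IHn. ring. }
    rewrite E. unfold Rdist. rewrite Rminus_diag, Rabs_R0. lra.
  - pose proof (cauchy_product (fun k => p k * exp (t * (INR k - mu)))
                  (fun j => conv p K j * exp (t * (INR j - INR K * mu)))
                  ltac:(intros; apply Rmult_le_pos; [auto|left; apply exp_pos])
                  ltac:(intros; apply Rmult_le_pos; [apply conv_nonneg|left; apply exp_pos])
                  Phi (Phi ^ K) HPhi IH) as H.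
    eapply series_ext; [|exact H]. intros j. unfold cauchy_coef. simpl conv.
    symmetry. match goal with |- ?S * ?E = _ => rewrite (Rmult_comm S E), scal_sum end.
    apply sum_eq. intros i Hi.
    rewrite minus_INR, S_INR by lia.
    replace (t * (INR j - (INR K + 1) * mu))
      with (t * (INR i - mu) + t * (INR j - INR i - INR K * mu)) by ring.
    rewrite exp_plus. ring.
Qed.

Lemma conv_mass (K : nat) : infinite_sum (conv p K) 1.
Proof.
  assert (E0 : forall y, exp (0 * y) = 1) by (intros; rewrite Rmult_0_l; apply exp_0).
  assert (H0 : infinite_sum (fun k => p k * exp (0 * (INR k - 0))) 1).
  { eapply series_ext; [|exact Hmass]. intros n; cbv beta; rewrite E0; ring. }
  pose proof (conv_mgf 0 0 1 H0 K) as H. rewrite pow1 in H.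
  eapply series_ext; [|exact H]. intros n; cbv beta; rewrite E0; ring.
Qed.

Lemma conv_some_pos (K : nat) : exists j, 0 < conv p K j.
Proof.
  apply NNPP. intros Hn.
  assert (Hz : forall j, conv p K j <= 0).
  { intros j. apply Rnot_lt_le. intros Hj. apply Hn. eauto. }
  pose proof (series_le _ _ _ _ (conv_mass K) series_zero Hz). lra.
Qed.

Lemma conv_weighted (K : nat) (phi : nat -> R) : (forall j, 0 <= phi j <= 1) ->
  exists v, infinite_sum (fun j => conv p K j * phi j) v /\ 0 <= v <= 1.
Proof.
  intros Hphi.
  assert (Hw : forall j, 0 <= conv p K j * phi j <= conv p K j).
  { intros j. pose proof (conv_nonneg K j). specialize (Hphi j). split; nra. }
  destruct (series_comparison _ _ 1 Hw (conv_mass K)) as [v [Hv Hle]].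
  exists v. split; [|split]; auto. apply (series_nonneg _ _ (fun j => proj1 (Hw j)) Hv).
Qed.

(** Expectations over paths.  [Summable n h f] says that every series met while
    unfolding [Ex p n h f] converges; under it [Ex] is a positive linear functional. *)

Fixpoint Summable (n : nat) (h : list nat) (f : list nat -> R) : Prop :=
  match n with
  | O => True
  | S n' => (forall j, Summable n' (h ++ [j]) f) /\
            exists l, infinite_sum (fun j => conv p (last h 0%nat) j * Ex p n' (h ++ [j]) f) l
  end.

Lemma length_app1 (h : list nat) (j : nat) : length (h ++ [j]) = S (length h).
Proof. rewrite length_app. simpl. lia. Qed.

Lemma Ex_last_step (n : nat) (h : list nat) (f : list nat -> R) : Ex p (S n) h f =
  Ex p n h (fun h' => Psum (fun j => conv p (last h' 0%nat) j * f (h' ++ [j]))).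
Proof.
  revert h. induction n as [|n IH]; intros h; [reflexivity|].
  change (Psum (fun j => conv p (last h 0%nat) j * Ex p (S n) (h ++ [j]) f) =
          Psum (fun j => conv p (last h 0%nat) j * Ex p n (h ++ [j])
                   (fun h' => Psum (fun j => conv p (last h' 0%nat) j * f (h' ++ [j]))))).
  f_equal. apply functional_extensionality. intros j. rewrite IH. reflexivity.
Qed.

Lemma Ex_ext (n : nat) (h : list nat) (f g : list nat -> R) :
  (forall h', length h' = (length h + n)%nat -> f h' = g h') ->
  Ex p n h f = Ex p n h g.
Proof.
  revert h. induction n as [|n IH]; intros h H; simpl.
  - apply H. lia.
  - f_equal. apply functional_extensionality. intros j. f_equal. apply IH.
    intros h' Hl. apply H. rewrite length_app1 in Hl. lia.
Qed.

Lemma Ex_le (n : nat) : forall h f g,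
  (forall h', length h' = (length h + n)%nat -> 0 <= f h' <= g h') ->
  Summable n h g -> Summable n h f /\ 0 <= Ex p n h f <= Ex p n h g.
Proof.
  induction n as [|n IH]; intros h f g H G; simpl.
  - split; [auto|]. apply H. lia.
  - destruct G as [G1 [lg Hlg]].
    assert (IHj : forall j, Summable n (h ++ [j]) f /\
                            0 <= Ex p n (h ++ [j]) f <= Ex p n (h ++ [j]) g).
    { intros j. apply IH; auto. intros h' Hl. apply H. rewrite length_app1 in Hl. lia. }
    assert (Hw : forall j, 0 <= conv p (last h 0%nat) j * Ex p n (h ++ [j]) f
                             <= conv p (last h 0%nat) j * Ex p n (h ++ [j]) g).
    { intros j. destruct (IHj j) as [_ [I1 I2]]. pose proof (conv_nonneg (last h 0%nat) j).
      split; [apply Rmult_le_pos|apply Rmult_le_compat_l]; auto. }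
    destruct (series_comparison _ _ lg Hw Hlg) as [lf [Hlf Hle]].
    split; [split; [intros j; apply IHj|exists lf; auto]|].
    rewrite (Psum_eq _ _ Hlf), (Psum_eq _ _ Hlg). split; auto.
    apply (series_nonneg _ _ (fun j => proj1 (Hw j)) Hlf).
Qed.

Lemma Ex_const (n : nat) : forall h a, Summable n h (fun _ => a) /\ Ex p n h (fun _ => a) = a.
Proof.
  induction n as [|n IH]; intros h a; simpl; auto.
  assert (Hs : infinite_sum (fun j => conv p (last h 0%nat) j * Ex p n (h ++ [j]) (fun _ => a)) a).
  { pose proof (series_scal _ _ a (conv_mass (last h 0%nat))) as H. rewrite Rmult_1_r in H.
    eapply series_ext; [|exact H]. intros j. cbv beta. rewrite (proj2 (IH _ _)). ring. }
  split; [split|]; [intros j; apply IH|exists a; auto|apply Psum_eq; auto].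
Qed.

Lemma Ex_bounded (n : nat) (h : list nat) (f : list nat -> R) (B : R) :
  (forall h', length h' = (length h + n)%nat -> 0 <= f h' <= B) ->
  Summable n h f /\ 0 <= Ex p n h f <= B.
Proof.
  intros H. destruct (Ex_const n h B) as [G E].
  destruct (Ex_le n h f (fun _ => B) H G) as [G' E']. rewrite E in E'. auto.
Qed.

Lemma Ex_linear (n : nat) : forall h f g a b, Summable n h f -> Summable n h g ->
  Summable n h (fun h' => a * f h' + b * g h') /\
  Ex p n h (fun h' => a * f h' + b * g h') = a * Ex p n h f + b * Ex p n h g.
Proof.
  induction n as [|n IH]; intros h f g a b Gf Gg; simpl; auto.
  destruct Gf as [Gf1 [lf Hlf]], Gg as [Gg1 [lg Hlg]].
  assert (Hs : infinite_sum (fun j => conv p (last h 0%nat) j *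
                 Ex p n (h ++ [j]) (fun h' => a * f h' + b * g h')) (a * lf + b * lg)).
  { pose proof (series_plus _ _ _ _ (series_scal _ _ a Hlf) (series_scal _ _ b Hlg)) as H.
    eapply series_ext; [|exact H]. intros j. cbv beta.
    rewrite (proj2 (IH _ _ _ a b (Gf1 j) (Gg1 j))). ring. }
  split; [split; [intros j; apply IH; auto|eexists; eauto]|].
  rewrite (Psum_eq _ _ Hs), (Psum_eq _ _ Hlf), (Psum_eq _ _ Hlg). reflexivity.
Qed.

Lemma Ex_pos (n : nat) : forall h f,
  (forall h', length h' = (length h + n)%nat -> 0 < f h') ->
  Summable n h f -> 0 < Ex p n h f.
Proof.
  induction n as [|n IH]; intros h f H G; simpl.
  - apply H; lia.
  - destruct G as [G1 [l Hl]]. rewrite (Psum_eq _ _ Hl).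
    assert (IHj : forall j, 0 < Ex p n (h ++ [j]) f).
    { intros j. apply IH; auto. intros h' Hl'. apply H. rewrite length_app1 in Hl'. lia. }
    destruct (conv_some_pos (last h 0%nat)) as [j Hj].
    refine (series_pos _ _ j _ (Rmult_lt_0_compat _ _ Hj (IHj j)) Hl).
    intros k. apply Rmult_le_pos; [apply conv_nonneg|left; apply IHj].
Qed.

(* Hölder's inequality in logarithmic form:
   E[e^{(1-s)X} e^{sY}] <= E[e^X]^{1-s} E[e^Y]^s.  It follows from the pointwise
   convexity bound after normalising [e^X] and [e^Y] by their expectations. *)
Lemma Ex_holder (n : nat) (h : list nat) (X Y : list nat -> R) (s : R) : 0 <= s <= 1 ->
  Summable n h (fun h' => exp (X h')) -> Summable n h (fun h' => exp (Y h')) ->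
  Summable n h (fun h' => exp ((1 - s) * X h' + s * Y h')) /\
  Ex p n h (fun h' => exp ((1 - s) * X h' + s * Y h'))
    <= exp ((1 - s) * ln (Ex p n h (fun h' => exp (X h')))
            + s * ln (Ex p n h (fun h' => exp (Y h')))).
Proof.
  intros Hs GX GY.
  set (a := Ex p n h (fun h' => exp (X h'))). set (b := Ex p n h (fun h' => exp (Y h'))).
  assert (Ha : 0 < a) by (apply Ex_pos; auto; intros; apply exp_pos).
  assert (Hb : 0 < b) by (apply Ex_pos; auto; intros; apply exp_pos).
  set (C := exp ((1 - s) * ln a + s * ln b)).
  assert (HC : 0 < C) by apply exp_pos.
  destruct (Ex_linear n h _ _ (C * (1 - s) / a) (C * s / b) GX GY) as [GL EL].
  assert (Hpt : forall h', 0 <= exp ((1 - s) * X h' + s * Y h')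
                  <= C * (1 - s) / a * exp (X h') + C * s / b * exp (Y h')).
  { intros h'. split; [left; apply exp_pos|].
    pose proof (exp_convex (1 - s) (X h' - ln a) (Y h' - ln b) ltac:(lra)) as Hcv.
    replace (1 - (1 - s)) with s in Hcv by ring.
    assert (EX : exp (X h' - ln a) = exp (X h') / a)
      by (unfold Rminus, Rdiv; rewrite exp_plus, exp_Ropp, exp_ln; auto).
    assert (EY : exp (Y h' - ln b) = exp (Y h') / b)
      by (unfold Rminus, Rdiv; rewrite exp_plus, exp_Ropp, exp_ln; auto).
    rewrite EX, EY in Hcv.
    replace (exp ((1 - s) * X h' + s * Y h'))
      with (C * exp ((1 - s) * (X h' - ln a) + s * (Y h' - ln b)))
      by (unfold C; rewrite <- exp_plus; f_equal; ring).
    apply Rle_trans with (C * ((1 - s) * (exp (X h') / a) + s * (exp (Y h') / b))).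
    - apply Rmult_le_compat_l; lra.
    - right. field. lra. }
  destruct (Ex_le n h _ _ (fun h' _ => Hpt h') GL) as [GS [_ HS]].
  split; auto. rewrite EL in HS. fold a b in HS.
  replace (C * (1 - s) / a * a + C * s / b * b) with C in HS by (field; lra). exact HS.
Qed.

(* Lyapunov's inequality E[Z^s] <= E[Z]^s for Z = e^g and 0 <= s <= 1
   (Hölder against the constant 1). *)
Lemma Ex_lyapunov (n : nat) (h : list nat) (g : list nat -> R) (s : R) : 0 <= s <= 1 ->
  Summable n h (fun h' => exp (g h')) ->
  Summable n h (fun h' => exp (s * g h')) /\
  Ex p n h (fun h' => exp (s * g h')) <= exp (s * ln (Ex p n h (fun h' => exp (g h')))).
Proof.
  intros Hs Gg.
  destruct (Ex_const n h (exp 0)) as [G0 E0].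
  destruct (Ex_holder n h (fun _ => 0) g s Hs G0 Gg) as [GH EH].
  rewrite E0, exp_0, ln_1 in EH.
  replace ((1 - s) * 0 + s * ln (Ex p n h (fun h' => exp (g h'))))
    with (s * ln (Ex p n h (fun h' => exp (g h')))) in EH by ring.
  assert (Hpt : forall h', length h' = (length h + n)%nat ->
                  0 <= exp (s * g h') <= exp ((1 - s) * 0 + s * g h')).
  { intros h' _. replace ((1 - s) * 0 + s * g h') with (s * g h') by ring.
    split; [left; apply exp_pos|lra]. }
  destruct (Ex_le n h _ _ Hpt GH) as [GS [_ HS]]. split; [auto|lra].
Qed.

Section Deviation.
Variables (m c : R).
Hypothesis Hm : infinite_sum (fun k => INR k * p k) m.
Hypothesis Hc : 0 < c.
Hypothesis Hmgf : forall t, -c <= t <= c ->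
  exists l, infinite_sum (fun k => p k * exp (t * (INR k - m))) l.

(* E[exp(t (Y - m))] >= 1 + t E[Y - m] = 1, from [exp u >= 1 + u]. *)
Lemma mgf_ge_1 (t Phi : R) :
  infinite_sum (fun k => p k * exp (t * (INR k - m))) Phi -> 1 <= Phi.
Proof.
  intros HPhi.
  assert (H : infinite_sum (fun k => p k + t * (INR k * p k) + (- (t * m)) * p k)
                           (1 + t * m + (- (t * m)) * 1)).
  { apply series_plus; [apply series_plus|]; auto; apply series_scal; auto. }
  replace 1 with (1 + t * m + - (t * m) * 1) by ring.
  apply (series_le _ _ _ _ H HPhi). intros k.
  pose proof (exp_ineq1_le (t * (INR k - m))). pose proof (Hp k).
  assert (p k * (1 + t * (INR k - m)) <= p k * exp (t * (INR k - m)))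
    by (apply Rmult_le_compat_l; lra).
  nra.
Qed.

Lemma Lf_val (t Phi : R) :
  infinite_sum (fun k => p k * exp (t * (INR k - m))) Phi -> Lf p m t = ln Phi.
Proof. intros H. unfold Lf. rewrite (Psum_eq _ _ H). reflexivity. Qed.

Lemma Lf_nonneg (t : R) : -c <= t <= c -> 0 <= Lf p m t.
Proof.
  intros Ht. destruct (Hmgf t Ht) as [Phi HPhi]. rewrite (Lf_val _ _ HPhi).
  rewrite <- ln_1. apply ln_le; [lra|]. apply (mgf_ge_1 _ _ HPhi).
Qed.

Lemma Lf_0 : Lf p m 0 = 0.
Proof.
  rewrite (Lf_val 0 1); [apply ln_1|]. eapply series_ext; [|exact Hmass].
  intros k; cbv beta. rewrite Rmult_0_l, exp_0. ring.
Qed.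

Definition rate_set (z : R) : R -> Prop :=
  fun y => exists t, -c <= t <= c /\ y = z * t - Lf p m t.

Lemma rate_set_0 (z : R) : rate_set z 0.
Proof. exists 0. split; [lra|]. rewrite Lf_0. ring. Qed.

(* The supremum exists since [L >= 0] bounds the set by [|z| c]. *)
Lemma If_lub (z : R) : is_lub (rate_set z) (If p m c z).
Proof.
  assert (Hb : bound (rate_set z)).
  { exists (Rabs z * c). intros y [t [Ht ->]]. pose proof (Lf_nonneg t Ht).
    assert (z * t <= Rabs z * c).
    { apply Rle_trans with (Rabs (z * t)); [apply Rle_abs|]. rewrite Rabs_mult.
      apply Rmult_le_compat_l; [apply Rabs_pos|apply Rabs_le; lra]. }
    lra. }
  destruct (completeness _ Hb (ex_intro _ 0 (rate_set_0 z))) as [M HM].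
  apply (epsilon_spec (inhabits 0) (is_lub (rate_set z))). exists M; auto.
Qed.

Lemma If_nonneg (z : R) : 0 <= If p m c z.
Proof. apply (If_lub z). apply rate_set_0. Qed.

Lemma Jf_nonneg (x : R) : 0 <= Jf p m c x.
Proof. unfold Jf. apply Rmin_glb; apply If_nonneg. Qed.

(** Chernoff bounds for the sum of [K] offspring variables. *)

(* Exponential Markov inequality at one parameter [t]: for [z t >= 0],
   P(z (Y_1+...+Y_K - m K) >= z^2 K) <= exp(-t z K) E[exp(t (Y_1+...+Y_K - m K))];
   for [z t < 0] the bound exceeds 1. *)
Lemma chernoff_at (K : nat) (z t : R) : z <> 0 -> -c <= t <= c ->
  Psum (fun j => conv p K j * indP (z * (INR j - m * INR K) >= z * z * INR K))
    <= exp (- INR K * (z * t - Lf p m t)).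
Proof.
  intros Hz Ht.
  destruct (conv_weighted K (fun j => indP (z * (INR j - m * INR K) >= z * z * INR K)))
    as [v [Hv Hv01]]; [intros; apply indP_01|].
  rewrite (Psum_eq _ _ Hv).
  pose proof (pos_INR K) as HK. pose proof (Lf_nonneg t Ht).
  destruct (Rle_lt_dec 0 (z * t)) as [Hzt|Hzt].
  2:{ apply Rle_trans with 1; [lra|]. apply exp_ge_1. nra. }
  destruct (Hmgf t Ht) as [Phi HPhi].
  pose proof (series_scal _ _ (exp (- (t * z * INR K))) (conv_mgf m t Phi HPhi K)) as HM.
  pose proof (mgf_ge_1 _ _ HPhi).
  replace (exp (- INR K * (z * t - Lf p m t))) with (exp (- (t * z * INR K)) * Phi ^ K).
  2:{ rewrite (Lf_val _ _ HPhi), <- (exp_ln Phi) at 1 by lra.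
      rewrite <- exp_INR_mul, <- exp_plus. f_equal. ring. }
  apply (series_le _ _ _ _ Hv HM). intros j. cbv beta.
  replace (exp (- (t * z * INR K)) * (conv p K j * exp (t * (INR j - INR K * m))))
    with (conv p K j * exp (- (t * z * INR K) + t * (INR j - INR K * m)))
    by (rewrite exp_plus; ring).
  apply Rmult_le_compat_l; [apply conv_nonneg|].
  unfold indP. destruct excluded_middle_informative as [E|E]; [|left; apply exp_pos].
  apply exp_ge_1.
  assert (0 <= (z * t) * (z * (INR j - m * INR K) - z * z * INR K)) by (apply Rmult_le_pos; lra).
  assert (0 < z * z) by nra.
  nra.
Qed.

Lemma chernoff (K : nat) (z : R) : z <> 0 ->
  Psum (fun j => conv p K j * indP (z * (INR j - m * INR K) >= z * z * INR K))
    <= exp (- INR K * If p m c z).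
Proof.
  intros Hz. apply (exp_bound_lub _ _ _ _ (If_lub z)).
  - pose proof (pos_INR K). lra.
  - intros y [t [Ht ->]]. apply chernoff_at; auto.
Qed.

Lemma conv_ratio_tail (K : nat) (x : R) : 0 < x ->
  Psum (fun j => conv p K j * indP (Rabs (INR j / INR K - m) >= x))
    <= 2 * exp (- Jf p m c x * INR K).
Proof.
  intros Hx.
  destruct (conv_weighted K (fun j => indP (Rabs (INR j / INR K - m) >= x))) as [v [Hv _]];
    [intros; apply indP_01|].
  destruct (conv_weighted K (fun j => indP (x * (INR j - m * INR K) >= x * x * INR K)))
    as [v1 [Hv1 _]]; [intros; apply indP_01|].
  destruct (conv_weighted K (fun j => indP (- x * (INR j - m * INR K) >= - x * - x * INR K)))
    as [v2 [Hv2 _]]; [intros; apply indP_01|].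
  pose proof (chernoff K x ltac:(lra)) as C1. pose proof (chernoff K (- x) ltac:(lra)) as C2.
  rewrite (Psum_eq _ _ Hv1) in C1. rewrite (Psum_eq _ _ Hv2) in C2. rewrite (Psum_eq _ _ Hv).
  assert (Hsplit : v <= v1 + v2).
  { apply (series_le _ _ _ _ Hv (series_plus _ _ _ _ Hv1 Hv2)). intros j. cbv beta.
    rewrite <- Rmult_plus_distr_l. apply Rmult_le_compat_l; [apply conv_nonneg|].
    apply indP_or. apply ratio_deviation_split; auto using pos_INR. }
  pose proof (pos_INR K).
  assert (exp (- INR K * If p m c x) <= exp (- Jf p m c x * INR K)).
  { apply exp_le_exp. pose proof (Rmin_l (If p m c x) (If p m c (- x))). unfold Jf. nra. }
  assert (exp (- INR K * If p m c (- x)) <= exp (- Jf p m c x * INR K)).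
  { apply exp_le_exp. pose proof (Rmin_r (If p m c x) (If p m c (- x))). unfold Jf. nra. }
  lra.
Qed.

(** The one-step estimator [X_n / X_(n-1)]. *)

(* Conditionally on the first [n] generations, the deviation probability of
   [X_(n+1) / X_n] is the conditional tail of a sum of [X_n] offspring variables. *)
Lemma mtilde_cond_tail (n : nat) (h : list nat) (x : R) : length h = S n -> 0 < x ->
  0 <= Psum (fun j => conv p (last h 0%nat) j *
                     indP (Rabs (mtilde (h ++ [j]) (S n) - m) >= x))
    <= 2 * exp (- Jf p m c x * INR (last h 0%nat)).
Proof.
  intros Hl Hx. set (K := last h 0%nat).
  replace (fun j => conv p K j * indP (Rabs (mtilde (h ++ [j]) (S n) - m) >= x))
    with (fun j => conv p K j * indP (Rabs (INR j / INR K - m) >= x)).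
  2:{ apply functional_extensionality. intros j. unfold mtilde. simpl (S n - 1)%nat.
      rewrite Nat.sub_0_r, Xk_app_eq, Xk_app_lt, Xk_last by lia. reflexivity. }
  split; [|apply conv_ratio_tail; auto].
  destruct (conv_weighted K (fun j => indP (Rabs (INR j / INR K - m) >= x))) as [v [Hv Hv01]];
    [intros; apply indP_01|].
  rewrite (Psum_eq _ _ Hv). lra.
Qed.

Lemma mtilde_tail (n : nat) (x : R) : (1 <= n)%nat -> 0 < x ->
  GWP p n (fun h => Rabs (mtilde h n - m) >= x)
    <= 2 * GWE p n (fun h => exp (- Jf p m c x * Xk h (n - 1))).
Proof.
  intros Hn Hx. destruct n as [|n]; [lia|]. replace (S n - 1)%nat with n by lia.
  unfold GWP, GWE. rewrite !Ex_last_step.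
  set (G := fun h' : list nat => exp (- Jf p m c x * INR (last h' 0%nat))).
  match goal with |- _ <= 2 * Ex _ _ _ ?F => rewrite (Ex_ext n [1%nat] F G) end.
  2:{ intros h' Hl. simpl in Hl. rewrite <- (proj2 (Ex_const 1 h' (G h'))). cbn [Ex].
      f_equal. apply functional_extensionality. intros j.
      rewrite Xk_app_lt, Xk_last by lia. reflexivity. }
  assert (HG : forall h', 0 <= G h' <= 1).
  { intros h'. unfold G. split; [left; apply exp_pos|apply exp_le_1].
    pose proof (Jf_nonneg x). pose proof (pos_INR (last h' 0%nat)). nra. }
  destruct (Ex_bounded n [1%nat] G 1 (fun h' _ => HG h')) as [GG _].
  destruct (Ex_linear n [1%nat] G G 2 0 GG GG) as [G2 E2].
  replace (2 * Ex p n [1%nat] G) with (Ex p n [1%nat] (fun h' => 2 * G h' + 0 * G h'))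
    by (rewrite E2; ring).
  apply (Ex_le n [1%nat] _ _); auto. intros h' Hl. simpl in Hl.
  rewrite Rmult_0_l, Rplus_0_r. apply (mtilde_cond_tail n h' x Hl Hx).
Qed.

(* Second bound, by Lyapunov's inequality:
   E[exp(-J X)] <= E[exp(-(q-1) J X)]^(1/q). *)
Lemma mtilde_tail_moment (n : nat) (x q : R) : (1 <= n)%nat -> 0 < x -> 1 < q ->
  GWP p n (fun h => Rabs (mtilde h n - m) >= x)
    <= 2 * Rpower (GWE p n (fun h => exp (- ((q - 1) * Jf p m c x * Xk h (n - 1))))) (1 / q).
Proof.
  intros Hn Hx Hq.
  eapply Rle_trans; [apply mtilde_tail; auto|].
  apply Rmult_le_compat_l; [lra|]. unfold GWE, Rpower.
  pose proof (Jf_nonneg x) as HJ. set (J := Jf p m c x) in *.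
  set (g := fun h => - ((q - 1) * J * Xk h (n - 1))).
  assert (Hs : 0 <= 1 / q <= 1).
  { split; [apply Rlt_le, Rdiv_lt_0_compat; lra|].
    apply Rmult_le_reg_r with q; [lra|]. field_simplify; lra. }
  assert (Hg : forall h, g h <= 0).
  { intros h. unfold g. pose proof (Xk_nonneg h (n - 1)).
    assert (0 <= (q - 1) * J * Xk h (n - 1))
      by (apply Rmult_le_pos; [apply Rmult_le_pos|]; lra). lra. }
  destruct (Ex_bounded n [1%nat] (fun h => exp (g h)) 1
              (fun h _ => conj (Rlt_le _ _ (exp_pos _)) (exp_le_1 _ (Hg h)))) as [Gg _].
  destruct (Ex_lyapunov n [1%nat] g (1 / q) Hs Gg) as [Gs Ly].
  eapply Rle_trans; [|exact Ly].
  apply (Ex_le n [1%nat] _ _); auto. intros h _. split; [left; apply exp_pos|].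
  apply exp_le_exp. unfold g. set (X := Xk h (n - 1)).
  assert (HX : 0 <= X) by apply Xk_nonneg.
  assert (0 <= J * X / q)
    by (apply Rmult_le_pos; [apply Rmult_le_pos; lra|left; apply Rinv_0_lt_compat; lra]).
  replace (1 / q * - ((q - 1) * J * X)) with (- J * X + J * X / q) by (field; lra).
  lra.
Qed.

(** The pooled estimator [(X_1+...+X_n) / (X_0+...+X_(n-1))]. *)

Definition mart_sum (h : list nat) (l : nat) : R := sumr (fun k => Xk h (S k) - m * Xk h k) l.
Definition pop_sum (h : list nat) (l : nat) : R := sumr (Xk h) l.

Definition exp_mart (u L : R) (h : list nat) (l : nat) : R :=
  exp (u * mart_sum h l - L * pop_sum h l).

Lemma pop_sum_nonneg (h : list nat) (l : nat) : 0 <= pop_sum h l.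
Proof. apply sumr_nonneg. intros; apply Xk_nonneg. Qed.

Lemma mart_sum_app (h : list nat) (j l : nat) : length h = S l ->
  mart_sum (h ++ [j]) (S l) = mart_sum h l + (INR j - m * INR (last h 0%nat)).
Proof.
  intros Hl. unfold mart_sum. simpl.
  rewrite (sumr_ext _ (fun k => Xk h (S k) - m * Xk h k))
    by (intros k Hk; rewrite !Xk_app_lt by lia; reflexivity).
  rewrite Xk_app_eq, Xk_app_lt, Xk_last by lia. reflexivity.
Qed.

Lemma pop_sum_app (h : list nat) (j l : nat) : length h = S l ->
  pop_sum (h ++ [j]) (S l) = pop_sum h l + INR (last h 0%nat).
Proof.
  intros Hl. unfold pop_sum. simpl.
  rewrite (sumr_ext _ (Xk h)) by (intros k Hk; apply Xk_app_lt; lia).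
  rewrite Xk_app_lt, Xk_last by lia. reflexivity.
Qed.

Lemma exp_mart_martingale (u Phi : R) :
  infinite_sum (fun k => p k * exp (u * (INR k - m))) Phi ->
  forall n h l, length h = S l ->
  Summable n h (fun h' => exp_mart u (ln Phi) h' (l + n)) /\
  Ex p n h (fun h' => exp_mart u (ln Phi) h' (l + n)) = exp_mart u (ln Phi) h l.
Proof.
  intros HPhi. pose proof (mgf_ge_1 _ _ HPhi) as HP1.
  induction n as [|n IH]; intros h l Hl; [simpl; rewrite Nat.add_0_r; auto|].
  replace (l + S n)%nat with (S l + n)%nat by lia.
  set (K := last h 0%nat). set (V := exp_mart u (ln Phi) h l).
  assert (IHj : forall j, Summable n (h ++ [j]) (fun h' => exp_mart u (ln Phi) h' (S l + n)) /\
            Ex p n (h ++ [j]) (fun h' => exp_mart u (ln Phi) h' (S l + n))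
              = exp_mart u (ln Phi) (h ++ [j]) (S l)).
  { intros j. apply IH. rewrite length_app1. lia. }
  pose proof (series_scal _ _ (V * exp (- (ln Phi * INR K))) (conv_mgf m u Phi HPhi K)) as HS.
  replace (V * exp (- (ln Phi * INR K)) * Phi ^ K) with V in HS.
  2:{ rewrite <- (exp_ln Phi) at 2 by lra. rewrite <- exp_INR_mul, Rmult_assoc, <- exp_plus.
      replace (- (ln Phi * INR K) + INR K * ln Phi) with 0 by ring. rewrite exp_0; ring. }
  assert (HS2 : infinite_sum (fun j => conv p K j *
                  Ex p n (h ++ [j]) (fun h' => exp_mart u (ln Phi) h' (S l + n))) V).
  { eapply series_ext; [|exact HS]. intros j. cbv beta. rewrite (proj2 (IHj j)).
    unfold V, exp_mart. rewrite mart_sum_app, pop_sum_app by auto. fold K.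
    replace (u * (mart_sum h l + (INR j - m * INR K)) - ln Phi * (pop_sum h l + INR K))
      with ((u * mart_sum h l - ln Phi * pop_sum h l) + - (ln Phi * INR K)
            + u * (INR j - INR K * m)) by ring.
    rewrite !exp_plus. ring. }
  split; [split; [intros j; apply IHj|eexists; exact HS2]|].
  simpl. fold K. apply Psum_eq. auto.
Qed.

Lemma pop_weight_bounds (n : nat) (q r : R) : 1 < q -> 0 <= r ->
  Summable n [1%nat] (fun h => exp (- ((q - 1) * r * pop_sum h n))) /\
  0 < Ex p n [1%nat] (fun h => exp (- ((q - 1) * r * pop_sum h n))) <= 1.
Proof.
  intros Hq Hr.
  assert (Hpt : forall h, 0 <= exp (- ((q - 1) * r * pop_sum h n)) <= 1).
  { intros h. split; [left; apply exp_pos|apply exp_le_1].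
    pose proof (pop_sum_nonneg h n).
    assert (0 <= (q - 1) * r * pop_sum h n) by (apply Rmult_le_pos; [apply Rmult_le_pos|]; lra).
    lra. }
  destruct (Ex_bounded n [1%nat] _ 1 (fun h _ => Hpt h)) as [G [_ H1]].
  split; [|split]; auto. apply Ex_pos; auto. intros; apply exp_pos.
Qed.

Lemma pop_weight_anti (n : nat) (q r r' : R) : 1 < q -> 0 <= r <= r' ->
  ln (Ex p n [1%nat] (fun h => exp (- ((q - 1) * r' * pop_sum h n))))
    <= ln (Ex p n [1%nat] (fun h => exp (- ((q - 1) * r * pop_sum h n)))).
Proof.
  intros Hq Hr.
  destruct (pop_weight_bounds n q r Hq ltac:(lra)) as [G _].
  destruct (pop_weight_bounds n q r' Hq ltac:(lra)) as [_ [Hpos _]].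
  apply ln_le; auto. apply (Ex_le n [1%nat] _ _); auto. intros h _.
  split; [left; apply exp_pos|]. apply exp_le_exp.
  pose proof (pop_sum_nonneg h n).
  assert (0 <= (q - 1) * pop_sum h n * (r' - r)) by (apply Rmult_le_pos; [apply Rmult_le_pos|]; lra).
  nra.
Qed.

(* One-sided bound at a single point [y = z u - L(u) >= 0] of [rate_set z]:
   on the event [z M_n >= z^2 S_n] we have
   1 <= exp((1-s)(u M_n - L S_n) + s (-(q-1) y S_n)) with s = 1/q,
   and Hölder's inequality against the martingale of mean 1 gives the bound. *)
Lemma mhat_holder_step (n : nat) (z q y : R) : z <> 0 -> 1 < q -> rate_set z y -> 0 <= y ->
  Ex p n [1%nat] (fun h => indP (z * mart_sum h n >= z * z * pop_sum h n))
    <= exp ((1 / q) * ln (Ex p n [1%nat] (fun h => exp (- ((q - 1) * y * pop_sum h n))))).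
Proof.
  intros Hz Hq [u [Hu Hy]] Hy0.
  destruct (Hmgf u Hu) as [Phi HPhi].
  pose proof (Lf_nonneg u Hu) as HL0. rewrite (Lf_val _ _ HPhi) in Hy, HL0.
  set (L := ln Phi) in *. set (s := 1 / q).
  assert (Hs : 0 < s < 1).
  { unfold s. split; [apply Rdiv_lt_0_compat; lra|].
    apply Rmult_lt_reg_r with q; [lra|]. field_simplify; lra. }
  destruct (exp_mart_martingale u Phi HPhi n [1%nat] 0 eq_refl) as [GM EM].
  assert (EM1 : exp_mart u L [1%nat] 0 = 1)
    by (unfold exp_mart, mart_sum, pop_sum; simpl; rewrite !Rmult_0_r, Rminus_0_r; apply exp_0).
  fold L in GM, EM. rewrite EM1 in EM.
  destruct (pop_weight_bounds n q y Hq Hy0) as [GW _].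
  destruct (Ex_holder n [1%nat] (fun h => u * mart_sum h n - L * pop_sum h n)
              (fun h => - ((q - 1) * y * pop_sum h n)) s ltac:(lra) GM GW) as [GH EH].
  change (fun h' => exp (u * mart_sum h' n - L * pop_sum h' n))
    with (fun h' => exp_mart u L h' (0 + n)) in EH.
  rewrite EM, ln_1, Rmult_0_r, Rplus_0_l in EH.
  eapply Rle_trans; [|exact EH].
  apply (Ex_le n [1%nat] _ _); auto. intros h _. split; [apply indP_01|].
  unfold indP. destruct excluded_middle_informative as [Ev|_]; [|left; apply exp_pos].
  apply exp_ge_1.
  (* the exponent equals (1-s) u (M_n - z S_n) >= 0 on the event *)
  set (M := mart_sum h n) in *. set (S := pop_sum h n) in *.
  replace ((1 - s) * (u * M - L * S) + s * - ((q - 1) * y * S))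
    with ((1 - s) * (u * (M - z * S))) by (unfold s; rewrite Hy; field; lra).
  assert (Huz : 0 <= u * z) by lra.
  assert (0 <= (u * z) * (z * M - z * z * S)) by (apply Rmult_le_pos; lra).
  assert (0 < z * z) by nra.
  assert (0 <= u * (M - z * S)) by nra.
  apply Rmult_le_pos; lra.
Qed.

(* One-sided bound at the rate [I(z)]: the point bounds pass to the supremum,
   using Lyapunov's inequality to compare the weights at [y] and at [I(z)]. *)
Lemma mhat_side_tail (n : nat) (z q : R) : z <> 0 -> 1 < q ->
  Ex p n [1%nat] (fun h => indP (z * mart_sum h n >= z * z * pop_sum h n))
    <= exp ((1 / q) * ln (Ex p n [1%nat]
                            (fun h => exp (- ((q - 1) * If p m c z * pop_sum h n))))).
Proof.
  intros Hz Hq. set (I0 := If p m c z). set (s := 1 / q).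
  assert (Hs : 0 < s) by (unfold s; apply Rdiv_lt_0_compat; lra).
  destruct (If_nonneg z) as [HI|HI].
  2:{ fold I0 in HI. rewrite <- HI. apply mhat_holder_step; auto. apply rate_set_0. lra. }
  fold I0 in HI.
  destruct (pop_weight_bounds n q I0 Hq ltac:(lra)) as [Gg [Hb0 Hb1]].
  set (b := Ex p n [1%nat] (fun h => exp (- ((q - 1) * I0 * pop_sum h n)))) in *.
  assert (Hlnb : ln b <= 0) by (rewrite <- ln_1; apply ln_le; auto).
  set (k := s * ln b / I0).
  assert (Hk : k <= 0).
  { unfold k, Rdiv. assert (0 < / I0) by (apply Rinv_0_lt_compat; lra).
    assert (s * ln b <= 0) by nra. nra. }
  replace (s * ln b) with (k * I0) by (unfold k; field; lra).
  apply (exp_bound_lub (rate_set z) _ k); [apply If_lub|exact Hk|].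
  intros y Hy.
  destruct (Rlt_le_dec y 0) as [Hyn|Hyp].
  - destruct (Ex_bounded n [1%nat] (fun h => indP (z * mart_sum h n >= z * z * pop_sum h n)) 1
                (fun h _ => indP_01 _)) as [_ [_ HP1]].
    apply Rle_trans with 1; auto. apply exp_ge_1. nra.
  - assert (HyI : y <= I0) by (apply (If_lub z); auto).
    set (t := y / I0).
    assert (Ht : 0 <= t <= 1).
    { unfold t. split; [apply Rmult_le_pos; [lra|left; apply Rinv_0_lt_compat; lra]|].
      apply Rmult_le_reg_r with I0; auto. unfold Rdiv. rewrite Rmult_assoc, Rinv_l by lra. lra. }
    destruct (Ex_lyapunov n [1%nat] (fun h => - ((q - 1) * I0 * pop_sum h n)) t Ht Gg)
      as [Gt Ly].
    assert (Et : (fun h => exp (t * - ((q - 1) * I0 * pop_sum h n)))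
                 = (fun h => exp (- ((q - 1) * y * pop_sum h n)))).
    { apply functional_extensionality. intros h. unfold t. f_equal. field. lra. }
    cbv beta in Gt, Ly. fold b in Ly. rewrite Et in Gt, Ly.
    eapply Rle_trans; [exact (mhat_holder_step n z q y Hz Hq Hy Hyp)|]. apply exp_le_exp.
    replace (k * y) with (s * (t * ln b)) by (unfold k, t; field; lra).
    apply Rmult_le_compat_l; [lra|].
    rewrite <- (ln_exp (t * ln b)). apply ln_le; auto.
    apply Ex_pos; auto. intros; apply exp_pos.
Qed.

(* Third bound: each one-sided deviation of the pooled estimator is controlled
   at rate [I(±x) >= J(x)], and [S_(n-1) = X_0+...+X_(n-1)] is [pop_sum h n]. *)
Lemma mhat_tail_moment (n : nat) (x q : R) : (1 <= n)%nat -> 0 < x -> 1 < q ->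
  GWP p n (fun h => Rabs (mhat h n - m) >= x)
    <= 2 * Rpower (GWE p n (fun h => exp (- ((q - 1) * Jf p m c x * Sk h (n - 1))))) (1 / q).
Proof.
  intros Hn Hx Hq. unfold GWP, GWE, Rpower.
  set (J := Jf p m c x).
  assert (HSk : forall h, Sk h (n - 1) = pop_sum h n).
  { intros h. unfold Sk, pop_sum. rewrite <- sumr_S. f_equal. lia. }
  set (ev := fun z h => indP (z * mart_sum h n >= z * z * pop_sum h n)).
  assert (Hside : forall z, z <> 0 -> J <= If p m c z ->
            Ex p n [1%nat] (ev z)
              <= exp (1 / q * ln (Ex p n [1%nat] (fun h => exp (- ((q - 1) * J * Sk h (n - 1))))))).
  { intros z Hz HJ. eapply Rle_trans; [exact (mhat_side_tail n z q Hz Hq)|].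
    apply exp_le_exp. apply Rmult_le_compat_l; [apply Rlt_le, Rdiv_lt_0_compat; lra|].
    rewrite (Ex_ext n [1%nat] (fun h => exp (- ((q - 1) * J * Sk h (n - 1))))
                              (fun h => exp (- ((q - 1) * J * pop_sum h n))))
      by (intros h _; rewrite HSk; reflexivity).
    apply pop_weight_anti; auto. split; [apply Jf_nonneg|auto]. }
  pose proof (Hside x ltac:(lra) (Rmin_l _ _)) as H1.
  pose proof (Hside (- x) ltac:(lra) (Rmin_r _ _)) as H2.
  destruct (Ex_bounded n [1%nat] (ev x) 1 (fun h _ => indP_01 _)) as [G1 _].
  destruct (Ex_bounded n [1%nat] (ev (- x)) 1 (fun h _ => indP_01 _)) as [G2 _].
  destruct (Ex_linear n [1%nat] (ev x) (ev (- x)) 1 1 G1 G2) as [G12 E12].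
  apply Rle_trans with (Ex p n [1%nat] (fun h => 1 * ev x h + 1 * ev (- x) h));
    [|rewrite E12; lra].
  apply (Ex_le n [1%nat] _ _); auto. intros h _. split; [apply indP_01|].
  rewrite !Rmult_1_l. apply indP_or. intros Hdev.
  assert (EM : mart_sum h n = sum_f_R0 (fun k => Xk h (S k)) (n - 1)
                              - m * sum_f_R0 (fun k => Xk h k) (n - 1)).
  { unfold mart_sum. rewrite sumr_minus_scal, <- !sumr_S. do 2 f_equal; f_equal; lia. }
  rewrite EM, <- HSk. apply ratio_deviation_split; auto;
    try (apply cond_pos_sum; intros; apply pos_INR).
Qed.

End Deviation.
End GaltonWatson.

Theorem corollary5p3 :
  forall (p : nat -> R) (m c : R),
    (forall k, 0 <= p k) ->
    infinite_sum p 1 ->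
    infinite_sum (fun k => INR k * p k) m ->
    1 < m ->
    (exists v, infinite_sum (fun k => (INR k - m) ^ 2 * p k) v) ->
    (forall n, GWP p n (fun h => nth n h 0%nat = 0%nat) = 0) ->
    0 < c ->
    (forall t, -c <= t <= c ->
       exists l, infinite_sum (fun k => p k * exp (t * (INR k - m))) l) ->
    forall (n : nat) (x : R), (1 <= n)%nat -> 0 < x ->
      GWP p n (fun h => Rabs (mtilde h n - m) >= x)
        <= 2 * GWE p n (fun h => exp (- Jf p m c x * Xk h (n - 1)))
      /\ (forall q, 1 < q ->
           GWP p n (fun h => Rabs (mtilde h n - m) >= x)
             <= 2 * Rpower (GWE p n (fun h => exp (- ((q - 1) * Jf p m c x * Xk h (n - 1))))) (1 / q))
      /\ (forall q, 1 < q ->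
           GWP p n (fun h => Rabs (mhat h n - m) >= x)
             <= 2 * Rpower (GWE p n (fun h => exp (- ((q - 1) * Jf p m c x * Sk h (n - 1))))) (1 / q)).
Proof.
  intros p m c Hp Hmass Hm _ _ _ Hc Hmgf n x Hn Hx.
  split; [|split].
  - exact (mtilde_tail p Hp Hmass m c Hm Hc Hmgf n x Hn Hx).
  - intros q Hq. exact (mtilde_tail_moment p Hp Hmass m c Hm Hc Hmgf n x q Hn Hx Hq).
  - intros q Hq. exact (mhat_tail_moment p Hp Hmass m c Hm Hc Hmgf n x q Hn Hx Hq).
Qed.
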